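(* For every integer $n \geq 7$, the second largest eigenvalue of $\Gamma_{n,n-5}$ is $$\lambda_2(\Gamma_{n,n-5}) = \frac{n(n-2)(n-3)(n-4)(n-6)}{5}.$$ Moreover, this eigenvalue is afforded by the irreducible character of $\mathrm{Sym}(n)$ corresponding to the partition $[n-1,1]$.
   Context: For integers $0 \leq k \leq n-1$, let $C(n,k)$ be the conjugacy class of $(n-k)$-cycles in $\mathrm{Sym}(n)$. In particular, $C(n,n-5)$ is the class of $5$-cycles. Let $\Gamma_{n,k} = \mathrm{Cay}(\mathrm{Sym}(n), C(n,k))$ be the Cayley graph with vertex set $\mathrm{Sym}(n)$, where $g$ and $h$ are adjacent if and only if $hg^{-1} \in C(n,k)$. The eigenvalues of a graph are the eigenvalues of its adjacency matrix, ordered $\lambda_1 \geq \lambda_2 \geq \cdots$ with multiplicity. Each irreducible character $\chi$ of $\mathrm{Sym}(n)$ gives an eigenvalue of $\Gamma_{n,k}$, namely $\frac{\chi(\sigma)}{\chi(\mathrm{id})}\,|C(n,k)|$ for any $\sigma \in C(n,k)$; this is the eigenvalue afforded by $\chi$. Irreducible characters of $\mathrm{Sym}(n)$ are indexed by partitions of $n$ in the standard way.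
   Formalization: ''Second largest eigenvalue'' is taken among distinct eigenvalues: counted with multiplicity, the valency |C| occurs twice (trivial and sign characters, since 5-cycles are even), so λ_2 would be |C| (504 rather than 84 for n = 7). *)

(* Defs.v *)
From mathcomp Require Import all_boot all_order all_algebra all_fingroup.
From mathcomp Require Import all_solvable all_field all_character.

Set Implicit Arguments.
Unset Strict Implicit.
Unset Printing Implicit Defensive.

Import Order.TTheory GroupScope GRing.Theory Num.Theory.
Local Open Scope ring_scope.

Definition cayley_rel (gT : finGroupType) (C : {set gT}) : rel gT :=
  fun g h => (h * g^-1)%g \in C.

Definition adjacency_mx (T : finType) (e : rel T) : 'M[algC]_#|T| :=
  \matrix_(i, j) (e (enum_val i) (enum_val j))%:R.

(* The complex roots of the characteristic polynomial, repeated according to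
   their multiplicities and listed in nonincreasing order. The order on algC is
   partial, but it is total on the reals, hence on the eigenvalues of a
   symmetric real matrix. *)
Definition eigenvalues (n : nat) (A : 'M[algC]_n) : seq algC :=
  sort (fun x y => y <= x) (sval (closed_field_poly_normal (char_poly A))).

(* The second largest among the DISTINCT eigenvalues. This matters when the
   graph is disconnected: 5-cycles are even, so they generate the alternating
   group, the Cayley graph has two components, and its valency is an eigenvalue
   of multiplicity 2. *)
Definition second_largest_eigenvalue (n : nat) (A : 'M[algC]_n) : algC :=
  nth 0 (undup (eigenvalues A)) 1.

Definition is_cycle_of_length (n m : nat) (s : 'S_n) : bool :=
  [exists x, (#|porbit s x| == m) && perm_on (porbit s x) s].

Definition cycle_class (n k : nat) : {set 'S_n} :=
  [set s | is_cycle_of_length (n - k)%N s].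

Definition Gamma (n k : nat) : rel 'S_n := cayley_rel (cycle_class n k).
Arguments Gamma : clear implicits.

(* Row and column groups of the tableau of shape la (a partition of n, given as
   its nonincreasing sequence of parts) whose rows, read one after the other,
   list 0, 1, ..., n - 1: the entry i lies in row reshape_index la i and in
   column reshape_offset la i. *)
Definition row_group (n : nat) (la : seq nat) : {set 'S_n} :=
  [set s : 'S_n | [forall i, reshape_index la (s i) == reshape_index la i]].

Definition col_group (n : nat) (la : seq nat) : {set 'S_n} :=
  [set s : 'S_n | [forall i, reshape_offset la (s i) == reshape_offset la i]].

(* The Young symmetrizer, as an element of the group algebra of Sym(n), that is,
   as a vector of the regular module. Since permutations are multiplied from
   left to right and modules are right modules, (p * q)%g corresponds to the
   product "q p" of the convention in which maps are composed from right to left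
   and modules are left modules; the submodule generated below is then the span
   of the polytabloids of shape la. *)
Definition young_symmetrizer (n : nat) (la : seq nat) :
    'rV[algC]_#|[set: 'S_n]%G| :=
  gring_row (\sum_(p in row_group n la) \sum_(q in col_group n la)
    (-1) ^+ q *: regular_repr algC [set: 'S_n]%G (p * q)%g).

(* The character of the Specht module of shape la, realized as the submodule of
   the regular module generated by the Young symmetrizer. *)
Definition specht_char (n : nat) (la : seq nat) : 'CF([set: 'S_n]) :=
  cfRepr (submod_repr (cyclic_mx_module
    (regular_repr algC [set: 'S_n]%G) (young_symmetrizer n la))).

(* Main.v *)
(* The eigenvalues of the Cayley graph are |C| chi(s) / chi(1), where s is a
   5-cycle and chi ranges over the irreducible characters, so the point is that
   chi(s) / chi(1) <= (n - 6) / (n - 1) for all nonlinear chi, when n >= 7. The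
   proof is by induction on n. Restrict chi to Sym(n - 1). If the restriction
   has no linear constituent, then chi(s) / chi(1) is a weighted average of
   ratios bounded by (n - 7) / (n - 2) < (n - 6) / (n - 1). Otherwise, up to a
   sign, chi is a nontrivial constituent of the permutation character, hence
   chi(s) = n - 6 and chi(1) = n - 1.
   The induction starts from the bound 1/6 = (7 - 6) / (7 - 1) for Sym(6), where
   the centraliser of s has order 5. By column orthogonality, |chi(s)|^2 <= 3 for
   nonlinear chi; and since all the nontrivial powers of s are conjugate,
   chi(1) + 4 chi(s) is 5 times the multiplicity of the trivial character in the
   restriction of chi to <s>, so that chi(s) is an integer congruent to chi(1)
   modulo 5. If chi(s) > 0 then chi(s) = 1 and therefore chi(1) >= 6. *)

Require Import Defs.
From mathcomp Require Import all_boot all_order all_algebra all_fingroup.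
From mathcomp Require Import all_solvable all_field all_character.
From mathcomp Require Import ring zify.

Set Implicit Arguments.
Unset Strict Implicit.
Unset Printing Implicit Defensive.

Import Order.TTheory GroupScope GRing.Theory Num.Theory.
Local Open Scope ring_scope.

(* all_solvable shadows perm.Sym, the permutations supported by a given set, by
   the group of all permutations of a type. *)
Local Notation Sym := perm.Sym.
Local Notation SymG := perm.Sym_group.

(** * 5-cycles *)

Section FiveCycles.

Variable T : finType.
Implicit Types (A B : {set T}) (s : {perm T}) (t : seq T).

(** The support is confined to a subset [A] of a fixed type, so that the induction can remove a
    point of [A] without changing the type of permutations. *)
Definition five_cycles A : {set {perm T}} :=
  [set s : {perm T} | [exists t : 5.-tuple T,
     [&& all (mem A) t, uniq t & [forall x, s x == next t x]]]].

Lemma five_cyclesP A s :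
  reflect (exists t, [/\ size t = 5%N, {subset t <= A}, uniq t & s =1 next t])
          (s \in five_cycles A).
Proof.
rewrite inE; apply: (iffP existsP).
  move=> [t /and3P[/allP tA Ut /eqfunP st]].
  by exists t; rewrite size_tuple.
move=> [t [sz_t tA Ut st]].
exists (tcast sz_t (in_tuple t)); rewrite val_tcast /= Ut.
by apply/andP; split; [apply/allP | apply/eqfunP].
Qed.

Lemma ex_perm_next t : uniq t -> exists s : {perm T}, s =1 next t.
Proof.
by move=> Ut; exists (perm (can_inj (prev_next Ut))) => x; rewrite permE.
Qed.

Lemma next_out t x : x \notin t -> next t x = x.
Proof. by move=> /negPf tx; rewrite next_nth tx. Qed.

Lemma five_cycles_perm_on A s : s \in five_cycles A -> s \in Sym A.
Proof.
case/five_cyclesP=> t [_ tA _ st]; rewrite inE; apply/subsetP=> x; rewrite inE.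
by apply: contraR => Ax; rewrite st next_out //; apply: contra Ax => /tA.
Qed.

Lemma five_cyclesS A B : A \subset B -> five_cycles A \subset five_cycles B.
Proof.
move/subsetP=> AB; apply/subsetP=> s /five_cyclesP[t [sz tA Ut st]].
by apply/five_cyclesP; exists t; split=> // x /tA /AB.
Qed.

(** Once the initial segments are matched by [u], composing with the transposition of [u x] and [y]
    matches the last entries and disturbs no earlier one. *)
Lemma Sym_tuple_trans A t t' :
    size t = size t' -> uniq t -> uniq t' ->
    {subset t <= A} -> {subset t' <= A} ->
  exists2 u : {perm T}, u \in Sym A & map u t = t'.
Proof.
elim/last_ind: t t' => [|t x IHt] t'; first by case: t' => // _; exists 1%g; rewrite ?group1.
case/lastP: t' => [|t' y]; rewrite !size_rcons // => -[sz_t].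
rewrite !rcons_uniq => /andP[tx Ut] /andP[t'y Ut'] tA t'A.
have memA (t0 : seq T) z : {subset rcons t0 z <= A} -> {subset t0 <= A} /\ z \in A.
  by move=> sub; split=> [w w_t0|]; apply: sub; rewrite mem_rcons inE ?eqxx ?w_t0 ?orbT.
have [[{}tA Ax] [{}t'A Ay]] := (memA _ _ tA, memA _ _ t'A).
have [u uA ut] := IHt t' sz_t Ut Ut' tA t'A.
have Aux: u x \in A by rewrite inE in uA; rewrite perm_closed.
exists (u * tperm (u x) y)%g.
  rewrite groupM //= inE; apply: subset_trans (tperm_on _ _) _.
  by apply/subsetP=> z; rewrite !inE => /orP[] /eqP->.
rewrite map_rcons permM tpermL; congr rcons; rewrite -ut.
apply/eq_in_map=> z tz; rewrite permM tpermD //; last first.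
  by apply: contraNneq t'y => ->; rewrite -ut map_f.
by rewrite (inj_eq perm_inj); apply: contraNneq tx => ->.
Qed.

Lemma five_cycles_conj A s s' :
  s \in five_cycles A -> s' \in five_cycles A -> s' \in s ^: Sym A.
Proof.
case/five_cyclesP=> t [sz_t tA Ut st] /five_cyclesP[t' [sz_t' tA' Ut' st']].
have [u uA ut] : exists2 u : {perm T}, u \in Sym A & map u t = t'.
  by apply: Sym_tuple_trans; rewrite // sz_t.
apply/imsetP; exists u => //; apply/permP=> x.
by rewrite -[x](permKV u) permJ st st' -ut next_map //; apply: perm_inj.
Qed.

Lemma five_cycles_class A s :
  s \in five_cycles A -> five_cycles A = s ^: Sym A.
Proof.
move=> As; apply/setP=> s'; apply/idP/imsetP => [As'|[u uA ->]].
  by have /imsetP := five_cycles_conj As As'.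
case/five_cyclesP: As => t [sz_t tA Ut st]; apply/five_cyclesP.
exists (map u t); rewrite size_map map_inj_uniq; last exact: perm_inj.
split=> // [_ /mapP[x /tA Ax ->]|x]; first by rewrite inE in uA; rewrite perm_closed.
by rewrite -[x](permKV u) permJ next_map ?st //; apply: perm_inj.
Qed.

(** The square of (a b c d e) is (a c e b d). By iteration, all nontrivial powers of a 5-cycle are
    5-cycles, hence conjugate. *)
Lemma five_cycles_expg2 A s : s \in five_cycles A -> (s ^+ 2)%g \in five_cycles A.
Proof.
case/five_cyclesP=> -[|a [|b [|c [|d [|e [|? ?]]]]]] [] //= _ tA Ut st; apply/five_cyclesP.
exists [:: a; c; e; b; d]; split=> //.
- move=> x; rewrite !inE => Hx; apply: tA; rewrite !inE.
  by do !case/orP: Hx => [->|Hx]; rewrite ?Hx ?orbT.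
- move: Ut => /=; rewrite !inE !negb_or !andbT -!andbA.
  case/and5P=> ? ? ? ? /and5P[? ? ? ? /andP[? ?]].
  by do ?[apply/andP; split]; rewrite // eq_sym.
move=> x; rewrite expgS expg1 permM !st.
have [tx|t'x] := boolP (x \in [:: a; b; c; d; e]); last first.
  rewrite !next_out //; apply: contra t'x; rewrite !inE.
  by do !case/orP => [->|]; rewrite ?orbT // => ->; rewrite ?orbT.
move: Ut => /=; rewrite !inE !negb_or !andbT -!andbA.
case/and5P=> /negPf ab /negPf ac /negPf ad /negPf ae.
case/and5P=> /negPf bc /negPf bd /negPf be /negPf cd /andP[/negPf ce /negPf de].
have neq := (eqxx, ab, ac, ad, ae, (bc, bd, be, cd, ce, de)).
have eqC (y z : T) b0 : (y == z) = b0 -> (z == y) = b0 by rewrite eq_sym.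
have neqC := (eqC _ _ _ ab, eqC _ _ _ ac, eqC _ _ _ ad, eqC _ _ _ ae,
  (eqC _ _ _ bc, eqC _ _ _ bd, eqC _ _ _ be, eqC _ _ _ cd, eqC _ _ _ ce, eqC _ _ _ de)).
by move: tx; rewrite !inE; do !case/orP=> [/eqP->|]; last move/eqP->; rewrite !(neq, neqC).
Qed.
Lemma fcycle_perm_next s t : uniq t -> s =1 next t -> fcycle s t.
Proof.
move=> Ut st; rewrite (eq_cycle (e' := frel (next t))) ?cycle_next // => x y /=.
by rewrite st.
Qed.

Lemma traject_next s t x : uniq t -> s =1 next t -> x \in t ->
  exists2 i, seq.rot i t = traject s x (size t) & iter (size t) s x = x.
Proof.
move=> Ut st tx; have [i t' def_t] := rot_to tx.
have Ct' : fcycle s (x :: t') by rewrite -def_t path.rot_cycle fcycle_perm_next.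
have sz_t : size t = (size t').+1 by rewrite -(size_rot i) def_t.
exists i; rewrite sz_t; first by rewrite def_t; exact: fcycle_consE.
have /(congr1 (last x)) := fcycle_rconsE Ct'.
by rewrite last_rcons trajectS /= last_traject -iterSr.
Qed.

Lemma porbit_next s t x : uniq t -> s =1 next t -> x \in t ->
  porbit s x = [set y in t].
Proof.
move=> Ut st tx; have [i rot_t iter_x] := traject_next Ut st tx.
apply/setP=> y; rewrite inE -(mem_rot i) rot_t.
apply/idP/trajectP=> [/porbitP[k ->]|[k _ ->]].
  have t0 : (0 < size t)%N by case: (t) tx.
  exists (k %% size t)%N; first by rewrite ltn_mod.
  rewrite permX {1}(divn_eq k (size t)) addnC iterD; congr iter.
  by elim: (k %/ _)%N => // m IHm; rewrite mulSn iterD IHm iter_x.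
by rewrite -permX mem_porbit.
Qed.

(** Bridge from the definition by orbits, used in the theorem, to the one by tuples. *)
Lemma five_cycles_setT s :
  [exists x, (#|porbit s x| == 5%N) && perm_on (porbit s x) s]
    = (s \in five_cycles setT).
Proof.
apply/existsP/five_cyclesP=> [[x /andP[/eqP o5 s_on]]|[t [sz_t _ Ut st]]].
  have U := uniq_traject_porbit s x; have sz := size_traject s x #|porbit s x|.
  have memE := porbit_traject s x; have := iter_porbit s x.
  set t := traject s x _ in U sz memE; rewrite o5 in sz => it5.
  exists t; split=> // [y|y]; first by rewrite inE.
  have [ty|t'y] := boolP (y \in t); last first.
    by rewrite next_out // (out_perm s_on) // memE.
  apply/esym/nextE => //; rewrite /t o5 /= !eqxx.
  by move: it5; rewrite o5 /= => ->; rewrite eqxx.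
case: t sz_t Ut st => [|x t] // sz_t Ut st; exists x.
rewrite (porbit_next Ut st) ?mem_head // cardsE (card_uniqP Ut) sz_t eqxx.
apply/subsetP=> y; rewrite !inE -in_cons; apply: contraR => t'y.
by rewrite st next_out.
Qed.

Lemma order_five_cycle A s : s \in five_cycles A -> #[s]%g = 5%N.
Proof.
case/five_cyclesP=> t [sz_t _ Ut st]; apply: nt_prime_order => //.
  apply/permP=> x; rewrite permX perm1.
  have [tx|t'x] := boolP (x \in t); last by apply: iter_fix; rewrite st next_out.
  by have [i _] := traject_next Ut st tx; rewrite sz_t.
case: t sz_t Ut st => [|a [|b t]] //= _ /andP[a'b _] st.
apply: contraNneq a'b => s1; have := st a.
by rewrite s1 perm1 /= eqxx => ->; apply: mem_head.
Qed.

(** Double counting of pairs of a 5-cycle and a 5-tuple presenting it: each cycle is presented by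
    five tuples, one for each starting point, and each repetition-free tuple in [A] presents exactly
    one cycle. *)
Lemma card_five_cycles A : (#|five_cycles A| * 5 = #|A| ^_ 5)%N.
Proof.
rewrite -(card_uniq_tuples _ [in A]); set D := [set t | _].
pose r (s : {perm T}) (t : seq T) := [forall x, s x == next t x].
transitivity (\sum_(s in five_cycles A) \sum_(t in D) r s t)%N.
  rewrite -sum_nat_const; apply: eq_bigr => s /five_cyclesP[t [sz_t tA Ut st]].
  rewrite -big_mkcondr sum1_card /= -[LHS]sz_t -(card_uniqP Ut).
  have szT x : size (traject s x 5) == 5%N by rewrite size_traject.
  rewrite -(card_in_imset (f := fun x => Tuple (szT x)) (D := [in t])); last first.
    by move=> x y _ _ /(congr1 val) /= [].
  apply: eq_card => t1; rewrite [RHS]unfold_in /=; apply/imsetP/idP => [[x tx ->]|].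
    have [i rot_t _] := traject_next Ut st tx; rewrite sz_t in rot_t.
    rewrite inE -[tval _]/(traject s x 5) -rot_t rot_uniq Ut andbT.
    apply/andP; split; first by apply/allP=> y; rewrite mem_rot; apply: tA.
    by apply/eqfunP=> y; rewrite next_rot.
  rewrite inE => /andP[/andP[/allP tA1 Ut1] /eqfunP st1].
  have sz_t1 := size_tuple t1; case def_t1: (val t1) => [|x t2].
    by rewrite def_t1 in sz_t1.
  have t1x : x \in val t1 by rewrite def_t1 mem_head.
  exists x; last first.
    apply: val_inj; rewrite /= def_t1; have := fcycle_perm_next Ut1 st1.
    rewrite def_t1 => /fcycle_consE ->.
    by move: sz_t1; rewrite def_t1 => /= -[->].
  apply: contraT => t'x; have := next_out t'x; rewrite -st st1.
  case: (t2) def_t1 sz_t1 Ut1 => [|y t3] -> //= _.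
  by rewrite eqxx => /[swap] ->; rewrite mem_head.
rewrite exchange_big /= -sum1_card; apply: eq_bigr => t; rewrite inE => /andP[tA Ut].
have [s st] := ex_perm_next Ut; rewrite (bigD1 s) /=; last first.
  by rewrite inE; apply/existsP; exists t; rewrite tA Ut; apply/eqfunP.
have -> : r s t by apply/eqfunP.
rewrite big1 // => s' /andP[_ ns]; case: (boolP (r s' t)) => // /eqfunP s't.
case/eqP: ns.
by apply/permP=> x; rewrite st s't.
Qed.

Lemma ex_five_cycle A : (5 <= #|A|)%N -> exists s, s \in five_cycles A.
Proof.
move=> A5; apply/set0Pn; rewrite -card_gt0 -(ltn_pmul2r (isT : 0 < 5)%N).
by rewrite card_five_cycles ffact_gt0.
Qed.

(** A 5-cycle is conjugate to its own square, which is even. *)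
Lemma odd_five_cycle A s : s \in five_cycles A -> odd_perm s = false.
Proof.
move=> As; have /imsetP[u _ ->] := five_cycles_conj (five_cycles_expg2 As) As.
by rewrite odd_permJ odd_permM addbb.
Qed.

Lemma card_fix_five_cycle A s :
  s \in five_cycles A -> (#|[set x in A | s x == x]| + 5 = #|A|)%N.
Proof.
case/five_cyclesP=> t [sz_t tA Ut st].
rewrite -sz_t -(card_uniqP Ut) -(cardsID [set x | x \in t] A) addnC; congr (_ + _)%N.
  by apply: eq_card => x; rewrite !inE andb_idl //; apply: tA.
apply: eq_card => x; rewrite !inE andbC; congr (_ && _).
have [tx|t'x] := boolP (x \in t); last by rewrite st next_out ?eqxx.
have [i] := rot_to tx; have Ur := Ut; rewrite -(rot_uniq i) in Ur.
rewrite st -(next_rot i Ut).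
case: t sz_t {tA st} tx Ut Ur => // a t sz_t tx Ut Ur [|b r] def_t.
  by move: (congr1 size def_t); rewrite size_rot sz_t.
rewrite def_t /= eqxx; move: Ur; rewrite def_t /= inE negb_or.
case/andP=> /andP[/negPf xb _] _.
by rewrite eq_sym.
Qed.

End FiveCycles.

(** * Character values at 5-cycles *)

Section SymCharacters.

Variable T : finType.
Implicit Types (A B : {set T}) (s : {perm T}).

Lemma five_cycle_cfun A (phi : 'CF(SymG A)) s s' :
  s \in five_cycles A -> s' \in five_cycles A -> phi s = phi s'.
Proof.
by move=> As As'; have /imsetP[u uA ->] := five_cycles_conj As As'; rewrite cfunJ.
Qed.

Lemma five_cycle_char A (chi : 'CF(SymG A)) s :
    chi \is a character -> s \in five_cycles A ->
  exists z k : int, chi s = z%:~R /\ chi 1%g = z%:~R + 5 * k%:~R.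
Proof.
move=> Nchi As; have GS : s \in SymG A := five_cycles_perm_on As.
have sHG : (<[s]> \subset SymG A)%g by rewrite cycle_subG.
have [Zm Z1] : '['Res[<[s]>%G] chi, 1] \in Num.nat /\ chi 1%g \in Num.nat.
  by rewrite Cnat_cfdot_char ?cfRes_char ?rpred1 // Cnat_char1.
have /natrP[m def_m] := Zm; have /natrP[d def_d] := Z1.
have sum_s : chi 1%g + 4 * chi s = 5 * m%:R.
  rewrite -def_m cfdotE -orderE (order_five_cycle As) mulVKf ?pnatr_eq0 //.
  rewrite (bigD1 1%g) ?group1 //= cfResE ?group1 // cfun1E group1 rmorph1 mulr1.
  rewrite (eq_bigr (fun _ => chi s)) => [|x /andP[sx ntx]].
    rewrite sumr_const; congr (_ + _); rewrite -[RHS]mulr_natl; congr (_%:R * _).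
    have := cardsD1 1%g <[s]>%g; rewrite group1 -orderE (order_five_cycle As) => -[->].
    by apply: eq_card => x; rewrite !inE andbC.
  rewrite cfResE // cfun1E sx rmorph1 mulr1; apply: (@five_cycle_cfun A) => //.
  have [k k5 def_x] := cyclePmin sx; rewrite (order_five_cycle As) in k5.
  (* Squaring yields the exponents 2, 4 and 8, and the last is 3 modulo the order 5, so that every
     nontrivial power is covered. *)
  have As2 := five_cycles_expg2 As; have As4 := five_cycles_expg2 As2.
  have As8 := five_cycles_expg2 As4; rewrite -!expgM in As4 As8.
  case: k k5 def_x => [|[|[|[|[|]]]]] // _ def_x; rewrite ?def_x ?expg1 //.
    by rewrite def_x expg0 eqxx in ntx.
  by rewrite -(expg_mod_order _ 8) (order_five_cycle As) in As8.
(* The sum over [<[s]>] makes chi(s) rational; being also an algebraic integer, it is an integer. *)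
have Zs : chi s \in Num.int.
  apply: Cint_rat_Aint; last exact: Aint_char.
  have -> : chi s = (5 * m%:R - d%:R) / 4.
    by rewrite -sum_s def_d addrAC subrr add0r mulrC mulKf ?pnatr_eq0.
  by rewrite rpred_div ?rpredB ?rpredM ?rpred_nat.
have /intrP[z def_z] := Zs; exists z, (m%:Z - z); split=> //.
rewrite rmorphB /= -[m%:~R]/(m%:R); move: sum_s; rewrite def_z => sum_s.
by rewrite mulrBr -sum_s; ring.
Qed.

End SymCharacters.

(** * Characters of symmetric groups *)

Section LinSym.
Variable T : finType.
Implicit Types (A B : {set T}) (s : {perm T}).

Definition sign_mx s : 'M[algC]_1 := ((-1) ^+ s)%:M.

Lemma sign_mx_repr A : mx_repr (SymG A) sign_mx.
Proof.
split=> [|s u _ _]; rewrite /sign_mx; first by rewrite odd_perm1.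
by rewrite odd_permM signr_addb scalar_mxM.
Qed.

Definition sign_char A : 'CF(SymG A) := cfRepr (MxRepresentation (sign_mx_repr A)).

Lemma sign_charE A s : s \in SymG A -> sign_char A s = (-1) ^+ s.
Proof. by move=> As; rewrite cfunE As mxtrace_scalar. Qed.

Lemma sign_lin_char A : sign_char A \is a linear_char.
Proof. by rewrite qualifE /= cfRepr_char cfRepr1 eqxx. Qed.

Lemma tperm_Sym A x y : x \in A -> y \in A -> tperm x y \in SymG A.
Proof.
move=> Ax Ay; rewrite inE; apply: subset_trans (tperm_on _ _) _.
by apply/subsetP=> z; rewrite !inE => /orP[] /eqP->.
Qed.

(** The transpositions of [A] are all conjugate, so [lam] takes a single value [e] on them, and [e]
    squares to 1. Since transpositions generate, [e] determines [lam]. *)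
Lemma lin_char_Sym A (lam : 'CF(SymG A)) :
  lam \is a linear_char -> lam = 1 \/ lam = sign_char A.
Proof.
move=> Llam.
have [e e1 lam_tperm] : exists2 e : algC, e = 1 \/ e = -1 &
    {in A &, forall x y, x != y -> lam (tperm x y) = e}.
  have [/existsP[x /existsP[y /and3P[Ax Ay xy]]]|noA] :=
      boolP [exists x, [exists y, [&& x \in A, y \in A & x != y]]]; last first.
    exists 1; first by left.
    move=> x y Ax Ay xy; case/existsP: noA; exists x; apply/existsP; exists y.
    by rewrite Ax Ay.
  exists (lam (tperm x y)).
    have /eqP : lam (tperm x y) ^+ 2 = 1.
      by rewrite -lin_charX ?tperm_Sym // expgS expg1 tperm2 lin_char1.
    by rewrite sqrf_eq1 => /orP[] /eqP; [left | right].
  move=> z w Az Aw zw.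
  have [||||u uA [<- <-]] := @Sym_tuple_trans _ A [:: x; y] [:: z; w] erefl.
  - by rewrite /= inE xy.
  - by rewrite /= inE zw.
  - by move=> v; rewrite !inE => /orP[] /eqP->.
  - by move=> v; rewrite !inE => /orP[] /eqP->.
  by rewrite -tpermJ cfunJ.
suff lamE : {in SymG A, forall s, lam s = e ^+ s}.
  case: e1 => def_e; [left | right]; apply/cfun_inP=> s As.
    by rewrite lamE // def_e expr1n cfun1E As.
  by rewrite lamE // def_e sign_charE.
move=> s; have [n] := ubnP #|[pred x | s x != x]|; elim: n s => // n IHn s /ltnSE le_s_n As.
have [x sx|s1] := pickP (fun x => s x != x); last first.
  have -> : s = 1%g by apply/permP=> x; rewrite perm1; apply/eqP/negbFE/s1.
  by rewrite odd_perm1 lin_char1.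
have Ax : x \in A by move: As; rewrite inE => /subsetP; apply; rewrite inE.
have Asx : s x \in A by rewrite inE in As; rewrite perm_closed.
(* Composing with this transposition makes [x] a fixed point and keeps every fixed point of [s], so
   that the number of moved points decreases. *)
pose s' := (s * tperm x (s x))%g.
have As' : s' \in SymG A by rewrite groupM ?tperm_Sym.
have ntx : x != s x by rewrite eq_sym.
have def_s : s = (s' * tperm x (s x))%g by rewrite -mulgA tperm2 mulg1.
rewrite {1}def_s lin_charM ?tperm_Sym // lam_tperm // IHn //; last first.
  apply: leq_trans le_s_n; apply: proper_card; apply/properP; split.
    apply/subsetP=> y; rewrite !inE /s' permM; apply: contraNneq => sy.
    rewrite sy tpermD //; first by apply: contraNneq sx => ->; rewrite sy.
    by apply: contraNneq sx => sxy; apply/eqP/(@perm_inj _ s); rewrite sxy sy.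
  by exists x; rewrite !inE // /s' permM tpermR eqxx.
have -> : odd_perm s' = ~~ odd_perm s by rewrite odd_permM odd_tperm ntx addbT.
case: (odd_perm s); rewrite /= ?expr0 ?expr1 ?mul1r //.
by case: e1 => ->; rewrite ?mulrNN mulr1.
Qed.

End LinSym.

(** * The permutation character and the standard character *)

Section StdChar.
Variable T : finType.
Implicit Types (A B : {set T}) (s : {perm T}).

Lemma mem_SymD1 A b s :
  (s \in SymG (A :\ b)) = (s \in SymG A) && (s b == b).
Proof.
rewrite !inE; apply/idP/andP=> [sAb|[sA /eqP sb]].
  split; first by apply: subset_trans sAb _; apply: subD1set.
  by rewrite (out_perm sAb) // !inE eqxx.
apply/subsetP=> x; rewrite !inE => sx.
rewrite (subsetP sA) ?inE // andbT.
by apply: contraNneq sx => ->; rewrite sb.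
Qed.

Lemma Sym_subD1 A b : SymG (A :\ b) \subset SymG A.
Proof. by apply/subsetP=> s; rewrite mem_SymD1 => /andP[]. Qed.

Lemma card_Sym_transporter A a b : a \in A -> b \in A ->
  #|[set s in SymG A | s a == b]| = #|SymG (A :\ b)|.
Proof.
move=> Aa Ab; rewrite -(card_lcoset (SymG (A :\ b)) (tperm a b)); apply: eq_card => s.
rewrite mem_lcoset mem_SymD1 [LHS]in_set tpermV groupMl ?tperm_Sym //.
by rewrite permM tpermR.
Qed.

(** In the sum over [u] defining the induced character, terms are grouped by the preimage [a] of [b]
    under [u]. Such a term is 1 exactly when [s] fixes [a], and each [a] arises from a coset of the
    stabiliser of [b]. *)
Lemma Ind_Sym1E A b s : b \in A -> s \in SymG A ->
  'Ind[SymG A, SymG (A :\ b)] 1 s = #|[set x in A | s x == x]|%:R.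
Proof.
move=> Ab As; rewrite cfIndE ?Sym_subD1 //; apply: (canLR (mulKf (neq0CG _))).
rewrite (partition_big (fun u : {perm T} => (u^-1)%g b) [in A]) /= => [|u Au]; last first.
  by have := groupVr Au; rewrite inE => Au'; rewrite perm_closed.
rewrite -sum1_card natr_sum mulr_sumr [RHS](eq_bigl _ _ (in_set _)) big_mkcondr /=.
apply: eq_bigr => a Aa.
rewrite (eq_bigr (fun _ => (s a == a)%:R)) => [|u /andP[Au /eqP ua]]; last first.
  rewrite cfun1E mem_SymD1 groupJ //= -{1 2}(permKV u b) permJ ua.
  by rewrite (inj_eq perm_inj).
have <- := card_Sym_transporter Aa Ab; rewrite sumr_const.
have -> : #|[pred u | (u \in SymG A) & ((u^-1)%g b == a)]| =
    #|[set s0 in SymG A | s0 a == b]|.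
  apply: eq_card => u; rewrite !inE; congr (_ && _).
  by rewrite -(inj_eq (@perm_inj _ u)) permKV eq_sym.
by case: (s a == a); rewrite ?mulr1 ?mulr0 ?mul0rn.
Qed.

Lemma cfdot_Ind_Sym1 A b : '['Ind[SymG A, SymG (A :\ b)] 1, 1] = 1.
Proof. by rewrite -cfdot_Res_r cfRes_cfun1 cfnorm1. Qed.

(** Frobenius reciprocity turns the norm into the multiplicity of 1 in the restriction to the
    stabiliser of [b]. This restriction is 1 plus the permutation character on the other points,
    which contains 1 once. *)
Lemma cfnorm_Ind_Sym1 A b :
  b \in A -> (1 < #|A|)%N -> '['Ind[SymG A, SymG (A :\ b)] 1] = 2.
Proof.
move=> Ab A2; rewrite -cfdot_Res_r.
have [c Bc] : exists c, c \in A :\ b.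
  by apply/set0Pn; rewrite -card_gt0; move: A2; rewrite (cardsD1 b) Ab.
have -> : 'Res[SymG (A :\ b)] ('Ind[SymG A] (1 : 'CF(SymG (A :\ b)))) =
    1 + 'Ind[SymG (A :\ b), SymG (A :\ b :\ c)] 1.
  apply/cfun_inP=> s Bs; have := Bs; rewrite mem_SymD1 => /andP[As sb].
  rewrite cfResE ?Sym_subD1 // !cfunE cfun1E Bs !Ind_Sym1E // -natrD.
  rewrite (cardsD1 b) inE Ab sb; congr (_ + _)%:R.
  by apply: eq_card => x; rewrite !inE andbA.
by rewrite cfdotDr cfnorm1 cfdotC cfdot_Ind_Sym1 rmorph1.
Qed.

(** A character of norm 2 containing the trivial character once is the sum of the latter and another
    irreducible character. *)
Lemma std_char_irr A b : b \in A -> (1 < #|A|)%N ->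
  'Ind[SymG A, SymG (A :\ b)] 1 - 1 \in irr (SymG A).
Proof.
move=> Ab A2; set phi := 'Ind _; have Nphi : phi \is a character.
  by rewrite cfInd_char ?rpred1.
rewrite irrEchar; apply/andP; split.
  have : 0 \in irr_constt phi.
    by rewrite irr_consttE irr0 cfdot_Ind_Sym1 oner_eq0.
  by case/constt_charP=> // psi Npsi ->; rewrite irr0 addrC addKr.
rewrite cfdotBl !cfdotBr (cfnorm_Ind_Sym1 Ab A2) cfnorm1.
rewrite [X in _ - (X - _)]cfdotC cfdot_Ind_Sym1.
by rewrite rmorph1 subrr subr0 addrK.
Qed.

(** By Frobenius reciprocity [chi] is a constituent of the permutation character, which has only
    two. *)
Lemma constt_Res_Sym1 A b (chi : 'CF(SymG A)) :
    b \in A -> (1 < #|A|)%N -> chi \in irr (SymG A) ->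
    '['Res[SymG (A :\ b)] chi, 1] != 0 ->
  chi = 1 \/ chi = 'Ind[SymG A, SymG (A :\ b)] 1 - 1.
Proof.
move=> Ab A2 /irrP[i ->]; rewrite cfdot_Res_l.
have /irrP[j def_j] := std_char_irr Ab A2.
rewrite -[X in '[_, X]](subrK 1) def_j -irr0 cfdotDr !cfdot_irr -natrD pnatr_eq0.
by rewrite addn_eq0 !eqb0 negb_and !negbK => /orP[] /eqP->; [right | left].
Qed.

End StdChar.

(** * The bound on character ratios *)

Section Bound.
Variable T : finType.
Implicit Types (A B : {set T}) (s : {perm T}).

Lemma card_cent_five_cycle A s :
  #|A| = 6%N -> s \in five_cycles A -> #|'C_(SymG A)[s]%g| = 5%N.
Proof.
move=> A6 As; have := Lagrange (subsetIl (SymG A) 'C[s]%g); rewrite index_cent1.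
have -> : #|SymG A| = 720%N by rewrite perm.card_Sym A6.
have := card_five_cycles A; rewrite A6 (five_cycles_class As) => C5.
have {C5} -> : #|s ^: SymG A|%g = 144%N.
  by apply/eqP; rewrite -(eqn_pmul2r (isT : 0 < 5)%N) C5.
by move=> h; apply/eqP; rewrite -(eqn_pmul2r (isT : 0 < 144)%N) h.
Qed.

Lemma sign_char_five_cycle A s : s \in five_cycles A -> sign_char A s = 1.
Proof.
by move=> As; rewrite sign_charE ?(odd_five_cycle As) ?(five_cycles_perm_on As).
Qed.

Lemma sign_char_neq1 A : (1 < #|A|)%N -> sign_char A != 1.
Proof.
case/card_gt1P=> x [y [Ax Ay xy]]; apply/eqP=> /cfunP/(_ (tperm x y)).
rewrite cfun1E tperm_Sym // sign_charE ?tperm_Sym // odd_tperm xy /= expr1.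
by move/eqP; rewrite eq_sym -subr_eq0 opprK -(natrD _ 1 1) pnatr_eq0.
Qed.

Lemma five_cycle_ratio6 A (chi : 'CF(SymG A)) s :
    #|A| = 6%N -> s \in five_cycles A -> chi \in irr (SymG A) -> chi 1%g != 1 ->
  chi s <= 6^-1 * chi 1%g.
Proof.
move=> A6 As /irrP[i ->] chi1.
have As' := five_cycles_perm_on As.
have /irrP[j def_j] := lin_char_irr (sign_lin_char A).
have Eo := second_orthogonality_relation s As'.
have j0 : j != 0.
  by apply: contraTneq (@sign_char_neq1 A _); rewrite ?A6 // def_j => ->; rewrite irr0 eqxx.
have i0 : i != 0 by apply: contraNneq chi1 => ->; rewrite irr0 cfun11.
have ij : i != j by apply: contraNneq chi1 => ->; rewrite -def_j lin_char1 ?sign_lin_char.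
have [z [k [def_s def_1]]] := five_cycle_char (irr_char i) As.
move: Eo; rewrite class_refl card_cent_five_cycle // mulr1n.
rewrite (bigD1 0) // (bigD1 j) //= (bigD1 i) ?i0 //= irr0 cfun1E As' rmorph1 -def_j.
rewrite sign_char_five_cycle // rmorph1 mulr1 def_s conj_intr ?intr_int //.
(* The trivial character, the sign and ['chi_i] contribute 1 + 1 + z^2 to the total 5; [r] collects
   the remaining squared moduli. *)
set r := \sum_(_ | _) _ => Eo.
have r0 : 0 <= r by apply: sumr_ge0 => l _; apply: mul_conjC_ge0.
have z3 : z * z <= 3.
  rewrite -(ler_int algC) rmorphM /= -subr_ge0.
  have -> : 3%:~R - z%:~R * z%:~R = r.
    apply/eqP; rewrite subr_eq -(inj_eq (addrI 2)); apply/eqP.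
    by rewrite -[3%:~R]/(3 : algC) -natrD -Eo; ring.
  by [].
have d0 : 0 < z + 5 * k.
  by have := irr1_gt0 i; rewrite def_1 -[5]/(5%:~R) -intrM -intrD ltr0z.
have d1 : z + 5 * k != 1.
  by move: chi1; rewrite def_1 -[5]/(5%:~R) -intrM -intrD -[1]/(1%:~R) eqr_int.
rewrite ler_pdivlMl // def_1 -[5]/(5%:~R) -[6]/(6%:~R) -!intrM -intrD ler_int.
(* Since z^2 <= 3, z is at most 1. If z = 1, the degree 1 + 5k is positive and not 1, hence at least
   6; if z <= 0, positivity of the degree suffices. *)
nia.
Qed.

(** The bound [c] for the smaller group is a parameter, so that the same step serves the passage
    from 6 to 7 points, with c = 1/6, and all later ones. *)
Lemma five_cycle_ratio_step A b s c :
    b \in A -> (7 <= #|A|)%N -> s \in five_cycles (A :\ b) ->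
    (forall psi : 'CF(SymG (A :\ b)), psi \in irr (SymG (A :\ b)) ->
       psi 1%g != 1 -> psi s <= c * psi 1%g) ->
    c <= (#|A|%:R - 6) / (#|A|%:R - 1) ->
  forall chi : 'CF(SymG A), chi \in irr (SymG A) -> chi 1%g != 1 ->
  chi s <= (#|A|%:R - 6) / (#|A|%:R - 1) * chi 1%g.
Proof.
move=> Ab A7 Bs boundB le_c chi irr_chi chi1; set B := A :\ b in Bs boundB *.
have As : s \in five_cycles A by apply: subsetP (five_cyclesS (subD1set A b)) s Bs.
have A2 : (1 < #|A|)%N by apply: leq_trans A7.
have n1 : #|A|%:R - 1 != 0 :> algC by rewrite subr_eq0 pnatr_eq1 gtn_eqF.
have std_ratio (phi : 'CF(SymG A)) : phi \in irr (SymG A) -> phi 1%g != 1 ->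
    '['Res[SymG B] phi, 1] != 0 -> phi s = (#|A|%:R - 6) / (#|A|%:R - 1) * phi 1%g.
  move=> irr_phi phi1 phiB1; have [def_phi|->] := constt_Res_Sym1 Ab A2 irr_phi phiB1.
    by rewrite def_phi cfun11 eqxx in phi1.
  rewrite !cfunE !Ind_Sym1E // ?(five_cycles_perm_on As) // !cfun1E.
  rewrite (five_cycles_perm_on As) group1.
  have -> : #|[set x in A | (1%g : {perm T}) x == x]| = #|A|.
    by apply: eq_card => x; rewrite inE perm1 eqxx andbT.
  by rewrite divfK // -(card_fix_five_cycle As) natrD /=; ring.
have Nres : 'Res[SymG B] chi \is a character by rewrite cfRes_char ?irrWchar.
have [/exists_inP[j chi_j lin_j]|noL] :=
    boolP [exists (j | j \in irr_constt ('Res[SymG B] chi)), 'chi_j \is a linear_char].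
  rewrite irr_consttE in chi_j; case: (lin_char_Sym lin_j) => def_j.
    by rewrite (std_ratio chi) // -def_j.
  (* If the sign occurs in the restriction, twisting [chi] by the sign reduces to the previous case
     and keeps the values at 1 and at the even permutation [s]. *)
  have Lsgn := sign_lin_char A.
  have sgn1 : (sign_char A * chi) 1%g = chi 1%g by rewrite cfunE lin_char1 ?mul1r.
  have <- : (sign_char A * chi) s = chi s by rewrite cfunE sign_char_five_cycle ?mul1r.
  rewrite -sgn1 std_ratio ?sgn1 ?mul_lin_irr //.
  have <- : '['Res[SymG B] chi, 'chi_j] = '['Res[SymG B] (sign_char A * chi), 1]; last by [].
  rewrite def_j !cfdotE; congr (_ * _); apply: eq_bigr => u Bu.
  have Au : u \in SymG A by apply: subsetP (Sym_subD1 A b) u Bu.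
  rewrite !cfResE ?Sym_subD1 // sign_charE // cfun1E Bu rmorph1 mulr1 cfunE sign_charE //.
  by rewrite mulrC rmorph_sign.
(* Without linear constituents, the bound [c] holds for each constituent and is summed with the
   multiplicities as nonnegative weights. *)
have chiE u : u \in SymG B -> chi u =
    \sum_(j in irr_constt ('Res[SymG B] chi)) '['Res[SymG B] chi, 'chi_j] * 'chi_j u.
  move=> Bu; rewrite -(cfResE _ (Sym_subD1 A b)) //.
  rewrite {1}[X in fun_of_cfun X _]cfun_sum_constt sum_cfunE.
  by apply: eq_bigr => j _; rewrite cfunE.
apply: (@le_trans _ _ (c * chi 1%g)); last first.
  by rewrite ler_wpM2r // char1_ge0 // irrWchar.
rewrite !chiE ?group1 ?(five_cycles_perm_on Bs) // mulr_sumr; apply: ler_sum => j chi_j.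
rewrite mulrCA ler_wpM2l ?natr_ge0 ?Cnat_cfdot_char_irr //.
apply: boundB; first exact: mem_irr.
apply: contraNneq noL => j1; apply/exists_inP; exists j => //.
by rewrite qualifE /= irr_char j1 eqxx.
Qed.

Lemma five_cycle_ratio A (chi : 'CF(SymG A)) s :
    (7 <= #|A|)%N -> s \in five_cycles A -> chi \in irr (SymG A) -> chi 1%g != 1 ->
  chi s <= (#|A|%:R - 6) / (#|A|%:R - 1) * chi 1%g.
Proof.
have [m] := ubnP #|A|; elim: m => // m IHm in A chi s * => /ltnSE le_A_m A7 As irr_chi chi1.
have [b Ab] : exists b, b \in A by apply/set0Pn; rewrite -card_gt0; apply: leq_trans A7.
have cardB := cardsD1 b A; rewrite Ab add1n in cardB.
have [u Bu] : exists u, u \in five_cycles (A :\ b).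
  by apply: ex_five_cycle; rewrite -ltnS -cardB ltnW.
have Au : u \in five_cycles A by apply: subsetP (five_cyclesS (subD1set A b)) u Bu.
rewrite (five_cycle_cfun chi As Au).
have [A7e|nA7] := eqVneq #|A| 7%N.
  apply: (five_cycle_ratio_step (c := 6^-1) Ab A7 Bu _ _ irr_chi chi1).
    move=> psi irr_psi psi1; apply: five_cycle_ratio6 => //.
    by apply/eqP; rewrite -eqSS -cardB A7e.
  rewrite A7e; have -> : 7 - 6 = 1 :> algC by ring.
  have -> : 7 - 1 = 6 :> algC by ring.
  by rewrite mul1r lexx.
pose c : algC := (#|A :\ b|%:R - 6) / (#|A :\ b|%:R - 1).
apply: (five_cycle_ratio_step (c := c) Ab A7 Bu _ _ irr_chi chi1); rewrite /c.
  move=> psi irr_psi psi1; apply: IHm => //.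
    by rewrite -cardB.
  by rewrite -ltnS -cardB ltn_neqAle eq_sym nA7.
have [k def_B] : exists k, #|A :\ b| = (7 + k)%N.
  exists (#|A :\ b| - 7)%N; rewrite subnKC // -ltnS -cardB ltn_neqAle eq_sym nA7.
  exact: A7.
have -> : #|A|%:R - 6 = (k + 2)%:R :> algC.
  by rewrite cardB def_B -natr1 !natrD; ring.
have -> : #|A|%:R - 1 = (k + 7)%:R :> algC.
  by rewrite cardB def_B -natr1 !natrD; ring.
have -> : #|A :\ b|%:R - 6 = (k + 1)%:R :> algC by rewrite def_B !natrD; ring.
have -> : #|A :\ b|%:R - 1 = (k + 6)%:R :> algC by rewrite def_B !natrD; ring.
rewrite ler_pdivrMr ?ltr0n ?addn_gt0 ?orbT // mulrAC.
rewrite ler_pdivlMr ?ltr0n ?addn_gt0 ?orbT //.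
(* This is (k + 1)(k + 7) <= (k + 2)(k + 6), where the two sides differ by 5. *)
by rewrite -!natrM ler_nat; lia.
Qed.

End Bound.

(** * Spectra of Cayley graphs *)

Section AdjacencySpectrum.

Lemma eigenvalue_adjacencyP (T : finType) (e : rel T) (a : algC) :
  eigenvalue (adjacency_mx e) a <->
  exists2 f : T -> algC, exists x, f x != 0 &
    forall y, \sum_x f x * (e x y)%:R = a * f y.
Proof.
split=> [/eigenvalueP[v Av nz_v]|[f [x fx] Af]].
  exists (fun x => v 0 (enum_rank x)).
    have /rV0Pn[i vi] := nz_v; exists (enum_val i); by rewrite enum_valK.
  move=> y; have /rowP/(_ (enum_rank y)) := Av; rewrite !mxE => <-.
  rewrite (reindex (@enum_val T T)) /=; last exact/onW_bij/enum_val_bij.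
  by apply: eq_bigr => i _; rewrite mxE enum_valK enum_rankK.
apply/eigenvalueP; exists (\row_i f (enum_val i)); last first.
  by apply/rV0Pn; exists (enum_rank x); rewrite mxE enum_rankK.
apply/rowP=> j; rewrite !mxE -Af (reindex (@enum_val T T)) /=; last first.
  exact/onW_bij/enum_val_bij.
by apply: eq_bigr => i _; rewrite !mxE.
Qed.

(** Every eigenvalue is comparable with the real number [b], hence real, so that the sorting is by a
    total order. The list without repetitions starts with [a]; its next entry is at most [b], and at
    least [b] because [b] is listed. *)
Lemma second_largest_eigenvalueE n (A : 'M[algC]_n) (a b : algC) :
    b \is Num.real -> b < a -> eigenvalue A a -> eigenvalue A b ->
    (forall x, eigenvalue A x -> x = a \/ x <= b) ->
  second_largest_eigenvalue A = b.
Proof.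
move=> Rb lt_ba Aa Ab A_le; rewrite /second_largest_eigenvalue.
set l := undup _; pose geC (x y : algC) := y <= x.
have geC_tr : transitive geC by move=> y x z yx zy; apply: le_trans zy yx.
have mem_roots x : (x \in eigenvalues A) = eigenvalue A x.
  rewrite mem_sort eigenvalue_root_char.
  case: (closed_field_poly_normal _) => r /= ->.
  by rewrite (monicP (char_poly_monic A)) scale1r root_prod_XsubC.
have mem_l x : (x \in l) = eigenvalue A x by rewrite mem_undup.
have A_real x : eigenvalue A x -> x \is Num.real.
  case/A_le=> [->|le_xb]; first by rewrite -(ler_real (ltW lt_ba)).
  by rewrite (ler_real le_xb).
have l_sorted : sorted geC l.
  apply: undup_sorted => //; apply: (sort_sorted_in (P := Num.real)) => [x y Rx Ry|].
    by apply: real_leVge.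
  by apply/allP=> x rx; apply: A_real; rewrite -mem_roots mem_sort.
have l_uniq : uniq l by apply: undup_uniq.
have la : a \in l by rewrite mem_l.
have lb : b \in l by rewrite mem_l.
have l_le x : x \in l -> x = a \/ x <= b by rewrite mem_l; apply: A_le.
case: l l_sorted l_uniq la lb l_le {mem_l} => [|x l] // xl_sorted /andP[l'x l_uniq] la lb l_le.
have x_max := order_path_min geC_tr xl_sorted.
have def_x : x = a.
  case: (l_le x (mem_head _ _)) => // le_xb.
  move: la; rewrite inE => /orP[/eqP //|/(allP x_max) le_ax].
  by have := lt_le_trans lt_ba (le_trans le_ax le_xb); rewrite ltxx.
rewrite inE def_x (lt_eqF lt_ba) /= in lb.
case: l l'x l_uniq lb l_le x_max xl_sorted {la} => [|y l] // l'x _ lb l_le _ /andP[_ yl_sorted].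
have le_yb : y <= b.
  case: (l_le y); rewrite ?inE ?eqxx ?orbT // => def_y.
  by rewrite inE def_x def_y eqxx in l'x.
apply/eqP; rewrite /= eq_le le_yb /=.
move: lb; rewrite inE => /orP[/eqP-> //|].
exact: allP (order_path_min geC_tr yl_sorted) b.
Qed.

End AdjacencySpectrum.

Section CayleySpectrum.

Variable gT : finGroupType.
Let G := [set: gT]%G.

(** The class sum is centralised by the group, so by Schur's lemma it acts as a scalar in the
    representation affording ['chi_i]; comparing traces identifies the scalar. *)
Lemma sum_irr_class (i : Iirr G) (s x : gT) :
  \sum_(c in s ^: G) 'chi_i (c * x)%g =
    'chi_i s / 'chi_i 1%g * #|s ^: G|%:R * 'chi_i x.
Proof.
pose rG := 'Chi_i; pose M := \sum_(c in (s ^: G)%g) rG c.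
have chiE y : 'chi_i y = \tr (rG y) by rewrite -irrRepr cfunE inE.
have [e def_M] : exists e, M = e%:M.
  apply/is_scalar_mxP/(mx_abs_irr_cent_scalar (groupC (socle_irr (socle_of_Iirr i)))).
  apply/centgmxP=> y Gy; rewrite mulmx_suml mulmx_sumr.
  rewrite [RHS](reindex_inj (conjg_inj y)) /=.
  apply: eq_big => [c|c _]; last by rewrite -!repr_mxM ?inE // conjgE !mulgA mulgV mul1g.
  by rewrite memJ_norm // (subsetP (class_norm s G)).
have trM : e * 'chi_i 1%g = #|s ^: G|%:R * 'chi_i s.
  rewrite chiE repr_mx1 -mxtraceZ scalemx1 -def_M raddf_sum /= mulr_natl -sumr_const.
  by apply: eq_bigr => _ /imsetP[y Gy ->]; rewrite -chiE cfunJ.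
rewrite -[_ / _ * _]mulrA [_^-1 * _]mulrC mulrA ['chi_i s * _]mulrC -trM mulfK ?irr1_neq0 //.
rewrite [in RHS]chiE -mxtraceZ -mul_scalar_mx -def_M mulmx_suml raddf_sum /=.
by apply: eq_bigr => c _; rewrite -repr_mxM ?inE // chiE.
Qed.

Lemma eigenvalue_cayley_class (s : gT) (a : algC) :
  eigenvalue (adjacency_mx (cayley_rel (s ^: G))) a <->
  exists i : Iirr G, a = 'chi_i s / 'chi_i 1%g * #|s ^: G|%:R.
Proof.
set C := (s ^: G)%g; pose omega (i : Iirr G) := 'chi_i s / 'chi_i 1%g * #|C|%:R.
split=> [/eigenvalue_adjacencyP[f [x fx] Af]|[i ->]].
  have [/existsP[i /eqP ->]|no_i] := boolP [exists i, a == omega i]; first by exists i.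
  (* The convolution phi i of f with 'chi_i is an eigenvector for both a and
     omega i, and the phi i cannot all vanish at x because the characters add up
     to the regular character. *)
  pose phi (i : Iirr G) g := \sum_h f h * 'chi_i (h * g^-1)%g.
  suff phi0 i : phi i x = 0.
    case/eqP: fx; apply: (mulfI (neq0CG G)); rewrite mulr0.
    transitivity (\sum_i 'chi_i 1%g * phi i x); last first.
      by rewrite big1 // => i _; rewrite phi0 mulr0.
    transitivity (\sum_h f h * cfReg G (h * x^-1)%g).
      rewrite (bigD1 x) //= mulgV cfRegE eqxx big1 ?addr0 1?mulrC // => h nxh.
      by rewrite cfRegE -eq_mulgV1 (negPf nxh) mulr0.
    under [RHS]eq_bigr do rewrite mulr_sumr.
    rewrite exchange_big /=; apply: eq_bigr => h _.
    rewrite cfReg_sum sum_cfunE mulr_sumr; apply: eq_bigr => i _.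
    by rewrite cfunE mulrCA.
  have : a * phi i x = omega i * phi i x.
    rewrite !mulr_sumr.
    under eq_bigr => h _ do rewrite mulrA -Af mulr_suml.
    rewrite exchange_big /=; apply: eq_bigr => g _.
    rewrite mulrCA -sum_irr_class mulr_sumr.
    rewrite (reindex_inj (mulIg g)) /= [RHS]big_mkcond /=; apply: eq_bigr => c _.
    rewrite /cayley_rel mulgK mulgA; case: (c \in C); by rewrite ?mulr1 ?mulr0 ?mul0r.
  move/eqP; rewrite -subr_eq0 -mulrBl mulf_eq0 subr_eq0 => /orP[/eqP aE|/eqP //].
  by case/existsP: no_i; exists i; apply/eqP.
(* The substitution x = c^-1 y turns the sum over the graph into that of [sum_irr_class], since y^-1
   c is conjugate to c y^-1. *)
apply/eigenvalue_adjacencyP; exists (fun g => 'chi_i g^-1%g).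
  by exists 1%g; rewrite invg1 irr1_neq0.
move=> y; rewrite -sum_irr_class [RHS]big_mkcond /=.
rewrite (reindex (fun c => c^-1 * y))%g /=; last first.
  exists (fun g => y * g^-1)%g => g _;
    by rewrite ?invMg ?invgK ?mulKVg ?mulgA ?mulgV ?mul1g ?mulgKV ?mulVg.
apply: eq_bigr => c _; rewrite /cayley_rel invMg invgK mulgA mulgV mul1g.
have -> : (y^-1 * c = (c * y^-1) ^ y)%g by rewrite conjgE mulgKV.
by rewrite cfunJ ?inE //; case: (c \in _); rewrite ?mulr1 ?mulr0.
Qed.

End CayleySpectrum.

(** * The Specht module of shape [n-1, 1] *)

Section QuasiIdempotent.

Variables (gT : finGroupType) (G : {group gT}) (Y : 'M[algC]_#|G|) (c : algC).
Let rG := regular_repr algC G.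
Hypotheses (RG_Y : (Y \in group_ring algC G)%MS) (c_neq0 : c != 0).
Hypothesis YY : Y *m Y = c *: Y.
Let u := gring_row Y.
Let L := \matrix_(i < #|G|) (u *m rG (enum_val i)).

(* L is the left multiplication by Y, so that c^-1 L is a projection onto the
   submodule generated by u, and it commutes with the action of G. *)
Lemma cfRepr_cyclic_quasi_idempotent x : x \in G ->
  cfRepr (submod_repr (cyclic_mx_module rG u)) x =
    c^-1 * \sum_i (u *m rG (enum_val i * x)%g) 0 i.
Proof.
move=> Gx; set U := cyclic_mx rG u.
have eqUL : (U :=: L)%MS.
  apply: (eqmx_trans (genmxE _)); set L' := _ *m _.
  have -> : L' = L; last exact: eqmx_refl.
  by apply/row_matrixP=> i; rewrite row_mul !rowK mul_rV_lin1 /= mxvecK.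
have mulL v : v *m L = u *m gring_mx rG v.
  rewrite /gring_mx /= [LHS]mulmx_sum_row (mulmx_sum_row v (enveloping_algebra_mx _)).
  rewrite linear_sum /= mulmx_sumr.
  by apply: eq_bigr => i _; rewrite !rowK linearZ /= mxvecK -scalemxAr.
have LL : L *m L = c *: L.
  apply/row_matrixP=> i; rewrite row_mul rowK mulL gring_mxJ ?enum_valP //.
  by rewrite gring_rowK // mulmxA -gring_row_mul YY !linearZ /= -scalemxAl rowK.
(* The rows of [B] form a basis of the submodule and [K] gives the coordinates of the projection, so
   that K B = c^-1 L and B K = 1. The matrix of [x] on the submodule is then B rG(x) K, whose trace
   is that of c^-1 L rG(x). *)
set B := val_submod (1%:M : 'M_(\rank U)).
have BL : B *m L = c *: B.
  have /submxP[D ->] : (B <= L)%MS by rewrite -eqUL val_submod1.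
  by rewrite -mulmxA LL scalemxAr.
set K := in_submod U (c^-1 *: L).
have KB : K *m B = c^-1 *: L.
  by rewrite -val_submodE in_submodK // eqUL scalemx_sub.
have BK : B *m K = 1%:M.
  apply: (@val_submod_inj _ _ U _); rewrite val_submodE -mulmxA KB -scalemxAr BL.
  by rewrite scalerA mulVf // scale1r.
rewrite cfunE Gx mulr1n /= /submod_mx; set X := in_submod _ _.
have XB : X *m B = B *m rG x.
  rewrite -val_submodE in_submodK //.
  by rewrite mxmodule_trans ?cyclic_mx_module ?val_submod1.
rewrite -[X]mulmx1 -BK mulmxA XB -mulmxA mxtrace_mulC -mulmxA KB.
rewrite -scalemxAr mxtraceZ mxtrace_mulC; congr (_ * _); apply: eq_bigr => i _.
have -> : (L *m rG x) i i = row i (L *m rG x) 0 i by rewrite [RHS]mxE.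
by rewrite row_mul rowK -mulmxA -repr_mxM ?enum_valP.
Qed.

End QuasiIdempotent.

Lemma Sym_setT (T : finType) : SymG [set: T] = [set: {perm T}]%G.
Proof. by apply/val_inj/setP=> s; rewrite !inE; apply/subsetP=> x; rewrite inE. Qed.

Section Specht.

Variables (n : nat) (b z0 : 'I_n).
Hypotheses (n_gt1 : (1 < n)%N) (def_b : b = n.-1 :> nat) (def_z0 : z0 = 0%N :> nat).
Notation G := [set: 'S_n]%G.
Let H := SymG ([set: 'I_n] :\ b).
Let la := [:: n.-1; 1%N].
Let t := tperm z0 b.

Let bz : b != z0.
Proof. by rewrite -val_eqE /= def_b def_z0; case: (n) n_gt1 => [|[]]. Qed.

Let mem_H s : (s \in H) = (s b == b).
Proof. by rewrite mem_SymD1 Sym_setT inE. Qed.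

(** The tableau has 0, ..., n - 2 in its first row and [b] = n - 1 alone in the second, below [z0] =
    0. *)
Lemma reshape_index_hook (i : 'I_n) : reshape_index la i = (i == b).
Proof.
rewrite /reshape_index /= -val_eqE /= def_b; have := ltn_ord i; have := n_gt1.
move: (nat_of_ord i) => j; case: (j =P n.-1); do 2?case: ifP; lia.
Qed.

Lemma reshape_offset_hook (i : 'I_n) : reshape_offset la i = if i == b then 0%N else i.
Proof.
rewrite /reshape_offset reshape_index_hook; case: eqVneq => [->|_] /=.
  by rewrite def_b addn0 subnn.
by rewrite subn0.
Qed.

Lemma row_group_hook : row_group n la = H.
Proof.
apply/setP=> s; rewrite mem_H inE; apply/forallP/eqP=> [/(_ b)|sb i].
  by rewrite !reshape_index_hook eqxx; case: (s b =P b).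
by rewrite !reshape_index_hook -{1}sb (inj_eq perm_inj).
Qed.

Lemma col_group_hook : col_group n la = [set 1%g; t].
Proof.
apply/setP=> s; rewrite inE !inE; apply/forallP/orP=> [s_fix|].
  have fix_s i : i != b -> i != z0 -> s i = i.
    move=> ib iz; have := s_fix i; rewrite !reshape_offset_hook (negPf ib).
    case: ifP => [_|_ /eqP /val_inj //]; rewrite eq_sym -def_z0 => /eqP /val_inj iz0.
    by rewrite iz0 eqxx in iz.
  have sb : s b = b \/ s b = z0.
    have := s_fix b; rewrite !reshape_offset_hook eqxx.
    case: (s b =P b) => [|_]; first by left.
    by rewrite -def_z0 => /eqP /val_inj; right.
  have sz : s z0 = b \/ s z0 = z0.
    have := s_fix z0; rewrite !reshape_offset_hook [z0 == b]eq_sym (negPf bz).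
    case: (s z0 =P b) => [|_]; first by left.
    by move=> /eqP /val_inj; right.
  have nsz : s z0 != s b by rewrite (inj_eq perm_inj) eq_sym.
  case: sb => sb; [left | right]; apply/eqP/permP=> i; rewrite ?perm1 /t.
    have [->//|ib] := eqVneq i b; have [->|iz] := eqVneq i z0; last exact: fix_s.
    by case: sz => // sz; rewrite sz sb eqxx in nsz.
  case: tpermP => [->|->//|/eqP iz /eqP ib]; last exact: fix_s.
  by case: sz => // sz; rewrite sz sb eqxx in nsz.
case=> /eqP-> i; rewrite ?perm1 // !reshape_offset_hook /t.
case: tpermP => [->|->|_ _]; rewrite ?eqxx // ?[z0 == b]eq_sym (negPf bz) def_z0 //.
Qed.

Let rG := regular_repr algC G.
Let h := \sum_(p in H) rG p.
Let Y := h *m (1%:M - rG t).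

Let rGM x y : rG (x * y)%g = rG x *m rG y.
Proof. by rewrite repr_mxM ?inE. Qed.

Let hH w : w \in H -> h *m rG w = h.
Proof.
move=> Hw; rewrite mulmx_suml [RHS](reindex_inj (mulIg w)) /=.
by apply: eq_big => [p|p _]; rewrite ?rGM // groupMr.
Qed.

Let Hh w : w \in H -> rG w *m h = h.
Proof.
move=> Hw; rewrite mulmx_sumr [RHS](reindex_inj (mulgI w)) /=.
by apply: eq_big => [p|p _]; rewrite ?rGM // groupMl.
Qed.

Let hh : h *m h = #|H|%:R *: h.
Proof.
rewrite {2}/h mulmx_sumr (eq_bigr (fun _ => h)) => [|p]; last exact: hH.
by rewrite sumr_const scaler_nat.
Qed.

Let tperm_J j : j != b -> exists2 w, w \in H & tperm b j = (t ^ w)%g.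
Proof.
move=> jb; exists (tperm z0 j); first by rewrite mem_H tpermD // eq_sym.
by rewrite tpermJ tpermL tpermD ?[z0 == b]eq_sym // tpermC.
Qed.

(* Grouping the elements of Sym(n) according to the image of b yields, up to the
   factor |H|, h * h for the image b, and h * t * h for each of the other images. *)
Let h_tperm_h :
  #|H|%:R *: (\sum_(x in G) rG x) = #|H|%:R *: h + n.-1%:R *: (h *m rG t *m h).
Proof.
have cosets_j j : \sum_(x in G | x b == j) rG x = h *m rG (tperm b j).
  rewrite mulmx_suml [LHS](reindex_inj (mulIg (tperm b j))) /=.
  apply: eq_big => [p|p _]; rewrite ?rGM // mem_H inE permM /=.
  by rewrite -[X in _ == X](tpermL b j) (inj_eq perm_inj).
have -> : #|H|%:R *: (\sum_(x in G) rG x) = (\sum_(x in G) rG x) *m h.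
  rewrite [RHS]mulmx_sumr [RHS](eq_bigr (fun _ => \sum_(x in G) rG x)) => [|p _].
    by rewrite sumr_const scaler_nat.
  rewrite mulmx_suml [RHS](reindex_inj (mulIg p)) /=.
  by apply: eq_big => [x|x _]; rewrite ?rGM // !inE.
rewrite (partition_big (fun x : 'S_n => x b) predT) //= mulmx_suml.
rewrite (bigD1 b) //= cosets_j tperm1 repr_mx1 mulmx1 hh; congr (_ + _).
(* The transpositions moving [b] are conjugate to [t] under [H], and [h] absorbs the conjugating
   elements on both sides. *)
rewrite (eq_bigr (fun _ => h *m rG t *m h)) => [|j jb]; last first.
  have [w Hw tw] := tperm_J jb; rewrite cosets_j tw conjgE !rGM.
  rewrite -!mulmxA Hh // mulmxA hH ?groupV //.
rewrite sumr_const scaler_nat; congr (_ *+ _).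
by rewrite (eq_card (B := predC1 b)) // cardC1 card_ord.
Qed.

(** Multiplying [h_tperm_h] by 1 - t kills the sum over the whole group, which absorbs [t], and
    expresses h t h (1 - t) as a multiple of [Y]. The constant is n!/(n - 1), the group order
    divided by the dimension of the module. *)
Let YY : Y *m Y = (#|H|%:R * n%:R / n.-1%:R) *: Y.
Proof.
have n1 : n.-1%:R != 0 :> algC by rewrite pnatr_eq0; lia.
have /(congr1 (mulmx^~ (1%:M - rG t))) := h_tperm_h.
rewrite mulmxDl -!scalemxAl mulmxBr mulmx1.
have -> : (\sum_(x in G) rG x) *m rG t = \sum_(x in G) rG x.
  rewrite mulmx_suml [RHS](reindex_inj (mulIg t)) /=.
  by apply: eq_big => [x|x _]; rewrite ?rGM // !inE.
rewrite subrr scaler0 -/Y => /eqP; rewrite eq_sym addrC addr_eq0 => /eqP hth.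
have -> : Y *m Y = #|H|%:R *: Y - h *m rG t *m h *m (1%:M - rG t).
  by rewrite {1}/Y mulmxBr mulmx1 {2}/Y mulmxBl !mulmxA hh -scalemxAl.
have -> : h *m rG t *m h *m (1%:M - rG t) = - (#|H|%:R / n.-1%:R) *: Y.
  apply: (scalerI n1); rewrite hth scalerA mulrN mulrC divfK // scaleNr //.
rewrite scaleNr opprK -scalerDl; congr (_ *: _).
have -> : n%:R = n.-1%:R + 1 :> algC by rewrite natr1 prednK //; lia.
by field.
Qed.

Let young_symmetrizerE : young_symmetrizer n la = gring_row Y.
Proof.
rewrite /young_symmetrizer row_group_hook col_group_hook; congr gring_row.
rewrite /Y mulmx_suml; apply: eq_bigr => p _.
rewrite big_setU1 /=; last first.
  rewrite inE eq_sym; apply/eqP=> /permP/(_ z0); rewrite tpermL perm1 => /eqP.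
  by rewrite (negPf bz).
rewrite big_set1 odd_perm1 odd_tperm eq_sym bz expr0 expr1 scale1r scaleN1r mulg1.
by rewrite rGM mulmxBr mulmx1.
Qed.

(** The trace on the Specht module involves these counts for [b] and [z0] only, coming from the
    terms 1 and [t] of the column group. *)
Let N (x : 'S_n) j := (\sum_(y in G) ((x ^ y)%g j == b))%N.

(** Divided by |H|, the count is the formula for the permutation character as induced from the
    stabiliser of [b]. *)
Let N_b x : N x b = (#|H| * #|[set i | x i == i]|)%N.
Proof.
apply/eqP; rewrite -(eqr_nat algC) natrM; apply/eqP.
have := @Ind_Sym1E _ [set: 'I_n] b x; rewrite cfIndE ?Sym_subD1 // Sym_setT !inE => /(_ isT isT).
move/(congr1 ( *%R #|H|%:R)); rewrite mulVKf ?neq0CG //.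
have -> : #|[set i in [set: 'I_n] | x i == i]| = #|[set i | x i == i]|.
  by apply: eq_card => i; rewrite !inE.
move=> <-; rewrite natr_sum; apply: eq_bigr => y _.
by rewrite cfun1E mem_H.
Qed.

Let N_z0 x : (n.-1 * N x z0 + N x b = n`!)%N.
Proof.
(* The stabiliser of b is transitive on the other points. *)
have N_j j : j != b -> N x j = N x z0.
  case/tperm_J=> w; rewrite mem_H => /eqP wb tw; have wz : w z0 = j.
    move/(congr1 (fun s : 'S_n => s b)): tw; rewrite tpermL -{1}wb permJ.
    by rewrite tpermR.
  rewrite /N (reindex_inj (mulIg w)) /=; apply: eq_big => [y|y _]; first by rewrite !inE.
  by rewrite -wz conjgM permJ -{1}wb (inj_eq perm_inj).
have -> : (n`! = \sum_j N x j)%N.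
  rewrite -card_Sn exchange_big /= -sum1_card; apply: eq_big => [y|y _]; first by rewrite !inE.
  rewrite (bigD1 ((x ^ y)^-1 b))%g //= permKV eqxx big1 // => j nj.
  by apply/eqP; rewrite eqb0; apply: contraNneq nj => <-; rewrite permK.
rewrite (bigD1 b) //= addnC; congr (_ + _)%N.
rewrite (eq_bigr (fun _ => N x z0)) // sum_nat_const; congr (_ * _)%N.
by rewrite (eq_card (B := predC1 b)) // cardC1 card_ord.
Qed.

Lemma specht_char_hook (x : 'S_n) : specht_char n la x = #|[set i | x i == i]|%:R - 1.
Proof.
have n1 : n.-1%:R != 0 :> algC by rewrite pnatr_eq0; lia.
have n0 : n%:R != 0 :> algC by rewrite pnatr_eq0; lia.
have H0 : #|H|%:R != 0 :> algC := neq0CG H.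
have c0 : #|H|%:R * n%:R / n.-1%:R != 0 :> algC by rewrite !mulf_neq0 ?invr_eq0.
have RG_Y : (Y \in group_ring algC G)%MS.
  apply: envelop_mxM; last first.
    by rewrite linearB /= addmx_sub ?eqmx_opp ?envelop_mx1 ?envelop_mx_id ?inE.
  by rewrite linear_sum summx_sub // => p _; rewrite envelop_mx_id ?inE.
rewrite /specht_char young_symmetrizerE.
rewrite (cfRepr_cyclic_quasi_idempotent RG_Y c0 YY) ?inE //.
have rowE g : gring_row (rG g) = delta_mx 0 (gring_index G g).
  by rewrite /gring_row rowK gring_indexK ?group1 // mul1g.
have deltaE g i : (delta_mx 0 (gring_index G g) : 'rV[algC]_#|G|) 0 i = (enum_val i == g)%:R.
  rewrite mxE eqxx /=; congr (nat_of_bool _)%:R.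
  by apply/eqP/eqP=> [->|<-]; rewrite ?gring_valK ?gring_indexK ?inE.
(* The only solution of u = p v is u v^-1, which lies in [H] exactly when v u^-1 fixes [b]. *)
have sumH u v : \sum_(p in H) (u == (p * v)%g)%:R = ((v * u^-1)%g b == b)%:R :> algC.
  rewrite -mem_H; have [Hvu|nHvu] := boolP (_ \in _).
    rewrite (bigD1 (u * v^-1)%g) /=; last by rewrite -groupV invMg invgK.
    rewrite mulgKV eqxx big1 ?addr0 // => p /andP[_ np].
    by case: eqP => // def_u; rewrite def_u mulgK eqxx in np.
  rewrite big1 // => p Hp; case: eqP => // def_u.
  by rewrite def_u invMg mulKVg groupV Hp in nHvu.
(* The diagonal entry at [z] is the coefficient of z in Y z x. The term 1 of the column group
   requires the conjugate of [x] by z^-1 to fix [b], the term [t] requires it to send [z0] to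
   [b]. *)
have -> : \sum_i (gring_row Y *m rG (enum_val i * x)%g) 0 i = (N x b)%:R - (N x z0)%:R.
  pose F (z : 'S_n) : algC := ((x ^ z^-1)%g b == b)%:R - ((x ^ z^-1)%g z0 == b)%:R.
  transitivity (\sum_(z in G) F z); last first.
    rewrite (reindex_inj invg_inj) /= !natr_sum -sumrB.
    by apply: eq_big => [z|z _]; rewrite ?inE // /F invgK.
  rewrite [RHS]big_enum_val; apply: eq_bigr => i _; set z := enum_val i.
  rewrite -gring_row_mul /Y mulmxBr mulmx1 mulmxBl -mulmxA -rGM.
  rewrite raddfB mxE [X in _ + X]mxE /h !mulmx_suml !raddf_sum !summxE; congr (_ - _).
    rewrite (eq_bigr (fun p => (z == (p * (z * x))%g)%:R)) => [|p _]; last first.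
      by rewrite -[LHS]/(gring_row (rG p *m rG _) 0 i) -rGM rowE deltaE.
    by rewrite sumH conjgE invgK mulgA.
  rewrite (eq_bigr (fun p => (z == (p * (t * (z * x)))%g)%:R)) => [|p _]; last first.
    by rewrite -[LHS]/(gring_row (rG p *m rG _) 0 i) -rGM rowE deltaE.
  by rewrite sumH -mulgA permM tpermR conjgE invgK mulgA.
have Nz : (N x z0)%:R = (n%:R * #|H|%:R - (N x b)%:R) / n.-1%:R :> algC.
  apply: (canRL (mulfK n1)); apply/eqP; rewrite eq_sym subr_eq -!natrM -natrD; apply/eqP.
  rewrite [(N x z0 * _)%N]mulnC N_z0 perm.card_Sym.
  have -> : #|[set: 'I_n] :\ b| = n.-1.
    have := cardsD1 b [set: 'I_n]; rewrite cardsT card_ord inE add1n.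
    by move/(congr1 predn) => /= <-.
  by congr _%:R; case: (n) n_gt1 => // k _; rewrite factS.
rewrite Nz N_b natrM.
have nE : n%:R = n.-1%:R + 1 :> algC by rewrite natr1 prednK //; lia.
rewrite nE in n0 *.
by field; rewrite n1 n0 H0.
Qed.

End Specht.

(** * Transfer to the group of all permutations, and the second eigenvalue *)

Section SymTypeCharacters.

Variable T : finType.
Let G := [set: {perm T}]%G.
Hypothesis T7 : (7 <= #|T|)%N.

Lemma irr_five_cycle_setT (s : {perm T}) (i : Iirr G) :
    s \in five_cycles [set: T] ->
  'chi_i s / 'chi_i 1%g = 1 \/
  'chi_i s / 'chi_i 1%g <= (#|T|%:R - 6) / (#|T|%:R - 1).
Proof.
(* The group [SymG [set: T]] equals [G] only propositionally; eliminating the equation transports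
   the index [i]. *)
rewrite /G in i *; move: i; case: _ / (Sym_setT T) => i Ts.
have [chi1|chi1] := eqVneq ('chi_i 1%g) 1; [left | right].
  rewrite chi1 divr1; have : 'chi_i \is a linear_char.
    by rewrite qualifE /= irr_char chi1 eqxx.
  case/lin_char_Sym=> ->; last by rewrite sign_char_five_cycle.
  by rewrite cfun1E (five_cycles_perm_on Ts).
rewrite ler_pdivrMr ?irr1_gt0 // -cardsT.
by apply: five_cycle_ratio; rewrite ?cardsT ?mem_irr.
Qed.

(** The standard character, given by its values so that it can be recognised as the character of the
    Specht module. *)
Lemma ex_std_irr_setT : exists i : Iirr G,
  forall s, 'chi_i s = #|[set x | s x == x]|%:R - 1.
Proof.
have /card_gt0P[b _] : (0 < #|T|)%N by apply: leq_trans T7.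
have def_G := Sym_setT T; rewrite /G; case: _ / def_G.
have T2 : (1 < #|[set: T]|)%N by rewrite cardsT; apply: leq_trans T7.
have /irrP[i def_i] := std_char_irr (in_setT b) T2.
exists i => s; have Ts : s \in SymG [set: T] by rewrite Sym_setT inE.
rewrite -def_i !cfunE Ind_Sym1E ?in_setT // cfun1E Ts; congr (_%:R - 1).
by apply: eq_card => x; rewrite !inE.
Qed.

End SymTypeCharacters.

Lemma natr_ffact5 (R : pzRingType) (n : nat) : (4 <= n)%N ->
  (n ^_ 5)%:R = n%:R * (n%:R - 1) * (n%:R - 2) * (n%:R - 3) * (n%:R - 4) :> R.
Proof.
move=> n4; have subE m : (m <= 4)%N -> (n - m)%:R = n%:R - m%:R :> R.
  by move=> m4; rewrite natrB // (leq_trans m4).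
by rewrite !ffactnSr ffactn0 mul1n subn0 !natrM !subE.
Qed.

Unset Implicit Arguments.

Theorem theorem1p5 (n : nat) (hn : (7 <= n)%N) :
  second_largest_eigenvalue (adjacency_mx (Gamma n (n - 5)%N)) =
    n%:R * (n%:R - 2) * (n%:R - 3) * (n%:R - 4) * (n%:R - 6) / 5
  /\ exists2 i : Iirr [set: 'S_n],
       'chi_i = specht_char n [:: n.-1; 1%N]
     & forall s : 'S_n, s \in cycle_class n (n - 5)%N ->
         'chi_i s / 'chi_i 1%g * #|cycle_class n (n - 5)%N|%:R =
           second_largest_eigenvalue (adjacency_mx (Gamma n (n - 5)%N)).
Proof.
have n_gt0 : (0 < n)%N by apply: leq_trans hn.
have ltn1 : (n.-1 < n)%N by rewrite prednK.
have T7 : (7 <= #|'I_n|)%N by rewrite card_ord.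
rewrite /Gamma; set C := cycle_class n (n - 5).
have def_C : C = five_cycles [set: 'I_n].
  apply/setP=> s; rewrite inE /is_cycle_of_length subKn ?five_cycles_setT //.
  by apply: leq_trans hn.
have [s Cs] : exists s, s \in C.
  by rewrite def_C; apply: ex_five_cycle; rewrite cardsT ltnW // ltnW.
have class_C x : x \in C -> C = (x ^: [set: 'S_n])%g.
  by rewrite def_C => /five_cycles_class ->; have /(congr1 val) /= -> := Sym_setT 'I_n.
have C5 : #|C|%:R * 5 =
    n%:R * (n%:R - 1) * (n%:R - 2) * (n%:R - 3) * (n%:R - 4) :> algC.
  rewrite -natr_ffact5; last by apply: leq_trans hn.
  by rewrite -(natrM _ _ 5) def_C card_five_cycles cardsT card_ord.
have C_gt0 : 0 < #|C|%:R :> algC by rewrite ltr0n card_gt0; apply/set0Pn; exists s.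
have n1_gt0 : 0 < n%:R - 1 :> algC by rewrite subr_gt0 ltr1n; apply: leq_trans hn.
(* The eigenvalue afforded by the standard character: a 5-cycle fixes n - 5 points, whence the value
   n - 6 against the degree n - 1. *)
pose lam : algC := (n%:R - 6) / (n%:R - 1) * #|C|%:R.
have [i chi_i] := ex_std_irr_setT T7.
have chi_ratio x : x \in C -> 'chi_i x / 'chi_i 1%g * #|C|%:R = lam.
  rewrite {1}def_C => Cx; rewrite /lam !chi_i; congr (_ / _ * _).
    have card_fix : (#|[set y | x y == y]| + 5)%N = n.
      rewrite -[RHS]card_ord -cardsT -(card_fix_five_cycle Cx); congr (_ + 5)%N.
      by apply: eq_card => y; rewrite !inE.
    have -> : #|[set y | x y == y]|%:R = n%:R - 5 :> algC.
      by apply: (canRL (addrK _)); rewrite -natrD; congr _%:R.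
    by ring.
  congr (_%:R - 1); rewrite -[RHS]card_ord -cardsT; apply: eq_card => y.
  by rewrite !inE perm1 eqxx.
have lam2 : second_largest_eigenvalue (adjacency_mx (cayley_rel C)) = lam.
  have := eigenvalue_cayley_class s; rewrite -(class_C s Cs) => spec.
  apply: (@second_largest_eigenvalueE _ _ #|C|%:R).
  - by rewrite rpredM ?rpred_div ?rpredB ?realn ?real1.
  - rewrite /lam gtr_pMl // ltr_pdivrMr // mul1r ltrD2l ltrN2 ltr1n //.
  (* The trivial character affords the valency, which is the largest eigenvalue. *)
  - apply/spec; exists 0; rewrite irr0 !cfun1E !inE divr1 mul1r //.
  - by apply/spec; exists i; rewrite chi_ratio.
  move=> x /spec[j ->]; rewrite def_C in Cs.
  have [->|le_j] := irr_five_cycle_setT T7 j Cs; first by left; rewrite mul1r.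
  by right; rewrite /lam ler_pM2r //; rewrite card_ord in le_j.
split.
  rewrite lam2 /lam; apply: (canRL (mulfK _)); first by rewrite pnatr_eq0.
  (* The factor n - 1 in 5 |C| cancels the denominator of [lam]. *)
  rewrite -[LHS]mulrA C5; have n1 := lt0r_neq0 n1_gt0.
  by field.
exists i; last by move=> x Cx; rewrite lam2 chi_ratio.
(* Both characters take the number of fixed points minus one as value. *)
apply/cfunP=> x; rewrite chi_i.
by rewrite (@specht_char_hook n (Ordinal ltn1) (Ordinal n_gt0)) //; apply: leq_trans hn.
Qed.
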